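(* Let $L$ be a frame whose cardinality is $|L|=4$. Then $|\mathrm{Arr}\langle L,L\rangle|\geq 4$.
   Context: A frame (also called a locale, when regarded as an object) is a complete lattice satisfying $a\wedge\bigvee_{i\in I}b_i=\bigvee_{i\in I}(a\wedge b_i)$. The arrows of the category of frames are the functions preserving finite meets (including the top element $1$) and arbitrary joins (including the bottom element $0$). $\mathrm{Arr}\langle A,B\rangle$ denotes the set of arrows of the category of frames with source $A$ and target $B$. *)

(* Defs.v *)
From HB Require Import structures.
From mathcomp Require Import all_boot all_order.
From mathcomp Require Import boolp classical_sets functions cardinality.

Set Implicit Arguments.
Unset Strict Implicit.
Unset Printing Implicit Defensive.

Import Order.TTheory.
Local Open Scope classical_set_scope.
Local Open Scope order_scope.

(* [supremums S] (resp. [infimums S]) is the set of least upper (resp. greatest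
   lower) bounds of [S]; by antisymmetry it has at most one element. *)
HB.mixin Record TBLattice_isComplete (d : Order.disp_t) L
    of Order.TBLattice d L := {
  bigjoin : set L -> L;
  bigmeet : set L -> L;
  bigjoinP : forall S : set L, supremums S (bigjoin S);
  bigmeetP : forall S : set L, infimums S (bigmeet S)
}.

#[short(type="completeLatticeType")]
HB.structure Definition CompleteLattice (d : Order.disp_t) :=
  {L of Order.TBLattice d L & TBLattice_isComplete d L}.

(* A family [b_i] enters only through its set of values. *)
HB.mixin Record CompleteLattice_isFrame (d : Order.disp_t) L
    of CompleteLattice d L := {
  meet_bigjoinr : forall (a : L) (S : set L),
    Order.meet a (bigjoin S) = bigjoin [set Order.meet a b | b in S]
}.

#[short(type="frameType")]
HB.structure Definition Frame (d : Order.disp_t) :=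
  {L of CompleteLattice d L & CompleteLattice_isFrame d L}.

(* The empty sequence gives [f \top = \top], the empty set [f \bot = \bot]. *)
Definition is_frame_morphism (d d' : Order.disp_t) (A : frameType d)
    (B : frameType d') (f : A -> B) : Prop :=
  (forall s : seq A, f (\meet_(x <- s) x) = \meet_(x <- s) f x) /\
  (forall S : set A, f (bigjoin S) = bigjoin (f @` S)).

Definition Arr (d d' : Order.disp_t) (A : frameType d) (B : frameType d') :
  set (A -> B) := [set f | is_frame_morphism f].

Arguments Arr {d d'} A B.

(* Main.v *)
Require Import Defs.
From mathcomp Require Import all_boot all_order.
From mathcomp Require Import boolp classical_sets functions cardinality.

(** Call the two elements of [L] other than [\bot] and [\top] [a] and [b].
    Besides the identity, endomorphisms of a frame arise from its points: an
    element [p <> \top] that is prime for binary meets gives the frame map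
    [L -> {0, 1}] with kernel the down-set of [p], and composing it with
    [{0, 1} -> L] gives [point_map p], an arrow with values in
    [{\bot, \top}] ([point_map_Arr]).  Distinct primes give distinct arrows, as
    [p] is the largest element sent to [\bot]; and a point map differs from any
    arrow that sends [a] to [a] or to [b].

    If [a] and [b] are comparable, then [L] is a chain, so [\bot], [a] and [b]
    are all prime, and the three point maps together with the identity are four
    arrows.  If they are not comparable, [L] is the Boolean algebra with two
    atoms: now only [a] and [b] are prime, but there is a nontrivial
    automorphism, the swap of [a] and [b]; it supplies the fourth arrow
    ([monotone_involution_Arr]). *)

Set Implicit Arguments.
Unset Strict Implicit.
Unset Printing Implicit Defensive.

Import Order.TTheory.
Local Open Scope classical_set_scope.
Local Open Scope order_scope.

Lemma uniq_card_ge (T : choiceType) (A : set T) (s : seq T) :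
  uniq s -> (forall x, x \in s -> A x) -> (`I_(size s) #<= A)%card.
Proof.
case: s => [|x0 s] Us sA; first by rewrite II0 card_ge0.
have inj : {in `I_(size (x0 :: s)) &, injective (nth x0 (x0 :: s))}.
  by move=> i j /set_mem ilt /set_mem jlt /eqP; rewrite nth_uniq // => /eqP.
rewrite -(card_le_eql (inj_card_eq inj)); apply: subset_card_le.
by move=> _ [i ilt <-]; apply/sA/mem_nth.
Qed.

Lemma card_enum (T : choiceType) (n : nat) (hT : ([set: T] #= `I_n)%card) :
  exists s : seq T, [/\ uniq s, size s = n & forall x, x \in s].
Proof.
have finT : finite_set [set: T] by exists n.
move: hT; rewrite card_eq_le => /andP[len gen].
exists (finmap.enum_fset (fset_set [set: T])); split.
- exact: finmap.fset_uniq.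
- by apply/eqP; rewrite eqn_leq geq_card_fset_set ?leq_card_fset_set.
- by move=> x; have := in_fset_set finT x; rewrite in_setT.
Qed.

Lemma tbPOrder_card4 (d : Order.disp_t) (L : tbPOrderType d)
    (hL : ([set: L] #= `I_4)%card) :
  exists a b : L, uniq [:: \bot; \top; a; b] /\
    forall x, x \in [:: \bot; \top; a; b].
Proof.
have [s [Us sz sL]] := card_enum hL.
have tNb : (\top : L) != \bot.
  apply/eqP => tb; have allb (x : L) : x = \bot.
    by apply/le_anti; rewrite le0x -tb lex1.
  have sub : {subset s <= [:: \bot]} by move=> x _; rewrite (allb x) mem_head.
  by have := uniq_leq_size Us sub; rewrite sz.
have Ut := rem_uniq \top (rem_uniq \bot Us).
have mt x : (x \in rem \top (rem \bot s)) = (x != \top) && (x != \bot).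
  by rewrite !(mem_rem_uniq, inE) ?rem_uniq// sL andbT.
have: size (rem \top (rem \bot s)) = 2%N.
  by rewrite !size_rem ?sz// mem_rem_uniq// !inE tNb sL.
move: Ut mt; case: (rem _ _) => [|a [|b []]]//= Uab mt _.
exists a, b; move: Uab; rewrite !inE !andbT => aNb.
have := mt a; have := mt b; rewrite !inE !eqxx orbT/= => /esym/andP[bt bb].
move=> /esym/andP[at_ ab]; split.
  rewrite ?inE !negb_or aNb !andbT [\bot == \top]eq_sym tNb.
  by rewrite ![\bot == _]eq_sym ![\top == _]eq_sym ab bb at_ bt.
move=> x; have := mt x; rewrite !inE.
by case: (x == \bot); case: (x == \top) => //= ->.
Qed.

Lemma bigjoin_leP (d : Order.disp_t) (L : frameType d) (S : set L) (u : L) :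
  bigjoin S <= u <-> (forall x, S x -> x <= u).
Proof.
have [ub lub] := bigjoinP S; split=> [Su x Sx|]; last exact: lub.
exact: le_trans (ub x Sx) Su.
Qed.

(** The hypothesis on joins is the universal property of the join of the image
    [f @` S], tested against upper bounds [u]. *)
Lemma ArrI (d d' : Order.disp_t) (A : frameType d) (B : frameType d')
    (f : A -> B) :
  f \top = \top -> {morph f : x y / x `&` y} ->
  (forall S (u : B), f (bigjoin S) <= u <-> (forall x, S x -> f x <= u)) ->
  Arr A B f.
Proof.
move=> f1 fI fJ; split=> [s|S].
  by elim: s => [|x s IH]; rewrite ?big_nil// !big_cons fI IH.
apply/le_anti/andP; split.
  by apply/fJ => x Sx; apply: (bigjoinP (f @` S)).1; exists x.
by apply/bigjoin_leP => _ [x Sx <-]; exact: ((fJ S _).1 (lexx _)).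
Qed.

Lemma id_Arr (d : Order.disp_t) (L : frameType d) : Arr L L id.
Proof. by apply: ArrI => // S u; exact: bigjoin_leP. Qed.

(** A monotone involution is an isomorphism of posets, and meets and joins are
    determined by the order alone. *)
Lemma monotone_involution_Arr (d : Order.disp_t) (L : frameType d)
    (f : L -> L) :
  involutive f -> {homo f : x y / x <= y} -> Arr L L f.
Proof.
move=> fK fle; have adj x y : (f x <= y) = (x <= f y).
  by apply/idP/idP => /fle; rewrite fK.
apply: ArrI => [|x y|S u].
- by apply/le_anti; rewrite lex1 -adj lex1.
- apply/le_anti; rewrite lexI !fle ?leIl ?leIr//= -adj lexI !adj.
  by rewrite leIl leIr.
- rewrite adj bigjoin_leP; split=> Su x /Su; by rewrite adj.
Qed.

Definition point_map (d : Order.disp_t) (L : tbPOrderType d) (p x : L) : L :=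
  if x <= p then \bot else \top.

(** A join lies below [p] iff all its terms do, which gives preservation of
    joins; primality of [p] says that a binary meet lies below [p] iff one of
    its terms does, which gives preservation of meets. *)
Lemma point_map_Arr (d : Order.disp_t) (L : frameType d) (p : L) :
  p != \top -> (forall x y, x `&` y <= p -> (x <= p) || (y <= p)) ->
  Arr L L (point_map p).
Proof.
move=> pN1 p_prime; apply: ArrI => [|x y|S u]; rewrite /point_map.
- by rewrite le1x (negPf pN1).
- have -> : (x `&` y <= p) = (x <= p) || (y <= p).
    apply/idP/idP; first exact: p_prime.
    by case/orP; apply: le_trans; rewrite (leIl, leIr).
  by case: (x <= p); case: (y <= p); rewrite /= ?meet0x ?meetx0 ?meetxx.
- case: ifPn => [/bigjoin_leP Sp|SNp].
    by split=> _; rewrite ?le0x// => x /Sp ->; exact: le0x.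
  split=> [u1 x _|Su]; first by case: ifP => _ //; exact: le0x.
  have [x Sx xNp] : exists2 x, S x & ~~ (x <= p).
    apply: contrapT => noS; case/negP: SNp; apply/bigjoin_leP => x Sx.
    by apply: contrapT => /negP xNp; apply: noS; exists x.
  by have := Su x Sx; rewrite (negPf xNp).
Qed.

Lemma point_map_inj (d : Order.disp_t) (L : tbPOrderType d) :
  \bot != \top :> L -> injective (@point_map d L).
Proof.
move=> bNt.
have kerE (p x : L) : (point_map p x == \bot) = (x <= p).
  by rewrite /point_map; case: ifP; rewrite ?eqxx// eq_sym (negPf bNt).
move=> p q pq; have E x : (x <= p) = (x <= q) by rewrite -!kerE pq.
by apply/le_anti; rewrite -E lexx E lexx.
Qed.

Lemma point_map_neq (d : Order.disp_t) (L : tbPOrderType d) (f : L -> L)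
    (p a : L) :
  f a != \bot -> f a != \top -> point_map p != f.
Proof.
move=> fab fat; apply/eqP => /(congr1 (@^~ a)) /= E; move: fab fat.
by rewrite -E /point_map; case: ifP; rewrite eqxx.
Qed.

Definition swap (T : eqType) (a b x : T) : T :=
  if x == a then b else if x == b then a else x.

Lemma swapK (T : eqType) (a b : T) : involutive (swap a b).
Proof.
move=> x; rewrite /swap; have [->|xa] := eqVneq x a.
  by rewrite eqxx; case: eqVneq.
by have [->|xb] := eqVneq x b; rewrite ?eqxx// (negPf xa) (negPf xb).
Qed.

Theorem proposition4p1 (d : Order.disp_t) (L : frameType d)
    (hL : ([set: L] #= `I_4)%card) :
  (`I_4 #<= Arr L L)%card.
Proof.
have [a [b [U Lab]]] := tbPOrder_card4 hL.
have L_cases (P : L -> Prop) : P \bot -> P \top -> P a -> P b -> forall x, P x.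
  by move=> ? ? ? ? x; have := Lab x; rewrite !inE => /or4P[] /eqP->.
move: U; rewrite /= !inE !negb_or !andbT.
case/and3P=> /and3P[bNt bNa bNb] /andP[tNa tNb] aNb.
have id_pm p : ((id : L -> L) == point_map p) = false.
  by apply: negbTE; rewrite eq_sym; apply: (@point_map_neq _ _ id p a);
    rewrite eq_sym.
have pm_eq p q : (@point_map d L p == point_map q) = (p == q).
  exact/inj_eq/point_map_inj.
have [ab|ab] := boolP (a >=< b).
- have tot : forall x y : L, x >=< y.
    have ba : b >=< a by rewrite comparable_sym.
    by apply: (L_cases); apply: (L_cases); rewrite ?ab ?ba ?comparablexx//
      /Order.comparable ?le0x ?lex1 ?orbT.
  have pm_Arr p : p != \top -> Arr L L (point_map p).
    move=> pN1; apply: point_map_Arr => // x y.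
    by case/orP: (tot x y) => [/meet_l->|/meet_r->] ->; rewrite ?orbT.
  apply: (@uniq_card_ge _ _
    [:: id; point_map \bot; point_map a; point_map b]) => [|f].
    by rewrite !cons_uniq !in_cons !in_nil !id_pm !pm_eq
      (negPf bNa) (negPf bNb) (negPf aNb).
  rewrite !inE => /or4P[] /eqP->; first exact: id_Arr.
  + exact: pm_Arr.
  + by apply: pm_Arr; rewrite eq_sym.
  + by apply: pm_Arr; rewrite eq_sym.
- have [aLb bLa] : ~~ (a <= b) /\ ~~ (b <= a) by apply/andP; rewrite -negb_or.
  (* [p] is prime because a least element [q] exists outside its down-set:
     a meet of two elements above [q] stays above [q]. *)
  have pm_Arr p q : p != \top -> ~~ (q <= p) ->
      (forall x, (x <= p) || (q <= x)) -> Arr L L (point_map p).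
    move=> pN1 qp pq; apply: point_map_Arr => // x y xyp.
    have := pq x; have := pq y; case: (x <= p) => //=.
    case: (y <= p) => //= qy qx.
    by case/negP: qp; apply: le_trans xyp; rewrite lexI qx qy.
  have sa : swap a b a = b by rewrite /swap eqxx.
  have sb : swap a b b = a by rewrite -{2}sa swapK.
  apply: (@uniq_card_ge _ _
    [:: id; point_map a; point_map b; swap a b]) => [|f].
    have swapN_pm p : (point_map p == swap a b) = false.
      by apply: negbTE; apply: (@point_map_neq _ _ _ _ a); rewrite sa eq_sym.
    have swapN_id : ((id : L -> L) == swap a b) = false.
      by apply/eqP => /(congr1 (@^~ a))/= /eqP; rewrite sa (negPf aNb).
    by rewrite !cons_uniq !in_cons !in_nil !id_pm !pm_eq !swapN_pm swapN_id
      (negPf aNb).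
  rewrite !inE => /or4P[] /eqP->; first exact: id_Arr.
  + apply: (@pm_Arr a b) => //; first by rewrite eq_sym.
    by apply: (L_cases); rewrite ?le0x ?lex1 ?lexx ?orbT.
  + apply: (@pm_Arr b a) => //; first by rewrite eq_sym.
    by apply: (L_cases); rewrite ?le0x ?lex1 ?lexx ?orbT.
  + have s0 : swap a b \bot = \bot by rewrite /swap (negPf bNa) (negPf bNb).
    have s1 : swap a b \top = \top by rewrite /swap (negPf tNa) (negPf tNb).
    apply: monotone_involution_Arr; first exact: swapK.
    by apply: (L_cases); apply: (L_cases); rewrite ?s0 ?s1 ?sa ?sb
      ?le0x ?lex1 ?lexx
      ?(negPf aLb) ?(negPf bLa) ?lex0 ?le1x ?[a == _]eq_sym ?[b == _]eq_sym
      ?(negPf bNt) ?(negPf bNa) ?(negPf bNb) ?(negPf tNa) ?(negPf tNb).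
Qed.
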